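(* Let $q=2^n$ with $n\geq 1$. Let $\ell$ and $r$ be integers with $\ell\geq 2$ and $r\geq 0$ such that $\ell/u$ is odd, where $u=\gcd(\ell,r)$. Let $\mathbf{T}_u:\mathbb{F}_{q^\ell}\to\mathbb{F}_{q^u}$ be the trace map. Let $a,b,c\in\mathbb{F}_{q^\ell}$ with $a\neq 0$, and let $a_1\in\mathbb{F}_{q^\ell}^*$ be the solution of $x^{q^r+1}=a$. Then $$N_{\ell,r}(a,b,c)=N_{\ell,r}(1,b\,a_1^{-1},c).$$ Moreover, if $\mathbf{T}_u(b)\notin\mathbb{F}_q^*$, then $N_{\ell,r}(1,b,c)=q^\ell$; otherwise, $$N_{\ell,r}(1,b,c)=q^\ell+\chi_1(\omega^{q^r+1}+\omega)\left(\frac{2}{\ell/u}\right)^{nu}q^{(\ell+u)/2}\,\chi_1\bigl(\mathbf{T}_u(b)^{-2}\,c\bigr),$$ where $\omega\in\mathbb{F}_{q^\ell}$ is such that $b\,\mathbf{T}_u(b)^{-1}=\omega^{q^{2r}}+\omega+1$.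
   Context: For $a,b,c\in\mathbb{F}_{q^\ell}$ with $a\neq 0$, $N_{\ell,r}(a,b,c)$ denotes the number of $\mathbb{F}_{q^\ell}$-rational affine points of the curve $y^q-y=ax^{q^r+1}+bx+c$, i.e. the number of pairs $(x,y)\in\mathbb{F}_{q^\ell}^2$ satisfying this equation. By convention $\gcd(\ell,0)=\ell$. The canonical additive character of $\mathbb{F}_{q^\ell}$ is $\chi_1(x)=\exp(2\pi\sqrt{-1}\,\mathbf{t}(x)/p)$, where $p$ is the characteristic (here $p=2$) and $\mathbf{t}:\mathbb{F}_{q^\ell}\to\mathbb{F}_p$ is the absolute trace map. For odd $v$, the Jacobi symbol is $\left(\frac{2}{v}\right)=1$ if $v\equiv\pm1\pmod 8$ and $\left(\frac{2}{v}\right)=-1$ if $v\equiv\pm3\pmod 8$. Under the hypotheses, $x\mapsto x^{q^r+1}$ is a permutation of $\mathbb{F}_{q^\ell}$ (so $a_1$ exists and is unique), and for every $b'\in\mathbb{F}_{q^\ell}$ with $\mathbf{T}_u(b')=1$ the equation $x^{q^{2r}}+x+1=b'$ has a solution in $\mathbb{F}_{q^\ell}$ (so $\omega$ exists). *)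

(* Defs.v *)
From HB Require Import structures.
From mathcomp Require Import all_boot all_order all_algebra all_field.
From mathcomp Require Import reals sequences exp trigo.
From mathcomp Require Import complex.

Set Implicit Arguments.
Unset Strict Implicit.
Unset Printing Implicit Defensive.

Import Order.TTheory GRing.Theory Num.Theory.
Local Open Scope ring_scope.

(* The subfield of F with q elements is the set of roots of X^q - X in F
   (F being an extension of that subfield); here without 0. *)
Definition subfield_star (F : finFieldType) (q : nat) : {set F} :=
  [set x : F | (x ^+ q == x) && (x != 0)].

(* Trace from the extension of degree m to its subfield with s elements, for
   #|F| = s ^ m; the values are seen in F:
   x + x^s + x^(s^2) + ... + x^(s^(m-1)). *)
Definition ff_trace (F : finFieldType) (s m : nat) (x : F) : F :=
  \sum_(i < m) x ^+ (s ^ i).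

(* p is meant to be the characteristic of F, so that #|F| = p ^ logn p #|F|.
   The trace down to the prime field is pulled back along the embedding
   k |-> k%:R of 'F_p into F; the default value 0 is never used. *)
Definition abs_trace (F : finFieldType) (p : nat) (x : F) : 'F_p :=
  odflt 0 [pick k : 'F_p | (k : nat)%:R == ff_trace p (logn p #|F|) x].

Definition cexp (R : realType) (z : R[i]) : R[i] :=
  Complex (expR (complex.Re z) * cos (complex.Im z))
          (expR (complex.Re z) * sin (complex.Im z)).

(* The element of 'F_p is read as its representative in {0, ..., p - 1}. *)
Definition chi1 (R : realType) (F : finFieldType) (p : nat) (x : F) : R[i] :=
  cexp (2 * Complex pi 0 * Complex 0 1 * (abs_trace p x : nat)%:R / p%:R).

(* The Jacobi symbol (2 / v), for odd v. *)
Definition jacobi2 (v : nat) : int :=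
  if (v %% 8)%N \in [:: 1; 7]%N then 1
  else if (v %% 8)%N \in [:: 3; 5]%N then -1 else 0.

(* The degree l of F over its subfield with q elements is determined by F. *)
Definition npoints (F : finFieldType) (q r : nat) (a b c : F) : nat :=
  #|[set P : F * F |
      P.2 ^+ q - P.2 == a * P.1 ^+ (q ^ r + 1) + b * P.1 + c]|.

(* Main.v *)
Require Import Defs.
From HB Require Import structures.
From mathcomp Require Import all_boot all_order all_algebra all_fingroup.
From mathcomp Require Import all_solvable all_field.
From mathcomp Require Import zify ring.
From mathcomp Require Import reals sequences exp trigo.
From mathcomp Require Import complex.

Set Implicit Arguments.
Unset Strict Implicit.
Unset Printing Implicit Defensive.

Import Order.TTheory GRing.Theory Num.Theory.
Local Open Scope ring_scope.

(** Over a finite field [F] of characteristic 2 the canonical additive character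
takes the values 1 and -1 only, so all exponential sums below are integer sums of
signs [psi x = (-1)^Tr(x)] ([trace_sign]).  Put [d = n * u], [k = n * r],
[v = l / u], and view the intermediate fields as the fixed sets of powers of
Frobenius in [F].

Scaling [x] by [a1] turns [a x^(q^r+1)] into [x^(q^r+1)], which gives the first
claim.  For the count, additive Hilbert 90 in character form
([card_artin_schreier]) writes the number of points as a sum over [t] in GF(q) and
[x] in [F] of [psi (t (x^(q^r+1) + b x + c))].  The term [t = 0] contributes
[q^l].  Every other [t] is a square [mu^2], and [x^(q^r+1)] is homogeneous of
degree 2 over GF(q), so that this term is [psi (mu^2 c)] times the sum [G(mu b)]
of [psi (x^(q^r+1) + (mu b) x)] ([npoints_twisted]).

The radical of the quadratic form [Tr (x^(q^r+1))] is the field with [q^u]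
elements; translating [x] by its elements shows that [G(beta)] vanishes unless
[T_u(beta) = 1] ([twisted_sum_eq0]).  As [T_u(mu b) = mu T_u(b)], at most the term
[mu = T_u(b)^-1] survives, and it does so exactly when [T_u(b)] is in GF(q)^*.
Completing the square with [omega] ([twisted_sum_shift]) reduces that term to
[G(1)], the sum of [psi (x^(2^k+1) + x)].

It remains to evaluate [G(1)] ([gold_sum_value]).  Squaring it and using
orthogonality gives [G(1)^2 = 2^(dv+d)], so only the sign is in doubt.  The sign is
found by induction on [v] along the tower of subfields of degree [d w], with [w]
dividing [v].  If [p] is a prime, the group of order [p] generated by Frobenius
acts on the extension of degree [p] and preserves the summand; its fixed points are
the subfield, so the two sums are congruent mod [p] ([gold_sum_modp]).  Since
[2^((p-1)/2)] is congruent to the Jacobi symbol [(2/p)] mod [p] ([euler_two]), each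
prime factor [p] of [v] multiplies the sign by [(2/p)^d]. *)

(** * Fields of characteristic 2: subfields, trace and its sign *)

Section BinaryField.
Variables (F : finFieldType) (m : nat).
Hypothesis cardF : #|F| = (2 ^ m)%N.

(** The subfield with [2^e] elements when [e] divides [m]; keeping subfields as
subsets of [F] lets every sum use the one character of [F]. *)
Definition fixed_field (e : nat) : {set F} := [set x | x ^+ (2 ^ e) == x].

(** The canonical additive character, with integer values. *)
Definition trace_sign (x : F) : int := if ff_trace 2 m x == 0 then 1 else -1.

Lemma pchar2F : 2 \in [pchar F].
Proof. exact: (card_finPcharP cardF). Qed.

Lemma dim_gt0 : (0 < m)%N.
Proof. by case: m cardF (finNzRing_gt1 F) => // ->. Qed.

Lemma addxx (x : F) : x + x = 0.
Proof. exact: addrr_pchar2 pchar2F x. Qed.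

Lemma oppF (x : F) : - x = x.
Proof. exact: oppr_pchar2 pchar2F x. Qed.

Lemma frobD e (x y : F) : (x + y) ^+ (2 ^ e) = x ^+ (2 ^ e) + y ^+ (2 ^ e).
Proof.
rewrite exprDn_pchar // (eq_pnat _ (pcharf_eq pchar2F)).
by rewrite pnatX pnat_id.
Qed.

Lemma frob_sum e (I : finType) (P : pred I) (f : I -> F) :
  (\sum_(i | P i) f i) ^+ (2 ^ e) = \sum_(i | P i) f i ^+ (2 ^ e).
Proof.
apply: (big_morph (fun x : F => x ^+ (2 ^ e)) (frobD e)).
by rewrite expr0n expn_eq0.
Qed.

Lemma frobA d e (x : F) : (x ^+ (2 ^ d)) ^+ (2 ^ e) = x ^+ (2 ^ (d + e)).
Proof. by rewrite -exprM expnD. Qed.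

Lemma frob_inj e : injective (fun x : F => x ^+ (2 ^ e)).
Proof.
move=> x y /= /eqP; rewrite -subr_eq0 -[- _]oppF opprK -frobD expf_eq0.
by case/andP => _; rewrite -[y in x + y]oppF subr_eq0 => /eqP.
Qed.

Lemma frob_card (x : F) : x ^+ (2 ^ m) = x.
Proof. by rewrite -cardF expf_card. Qed.

Lemma fixedP e (x : F) : reflect (x ^+ (2 ^ e) = x) (x \in fixed_field e).
Proof. by rewrite inE; apply: eqP. Qed.

Lemma fixedD e x y :
  x \in fixed_field e -> y \in fixed_field e -> x + y \in fixed_field e.
Proof. by move=> /fixedP hx /fixedP hy; apply/fixedP; rewrite frobD hx hy. Qed.

Lemma fixedM e x y :
  x \in fixed_field e -> y \in fixed_field e -> x * y \in fixed_field e.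
Proof. by move=> /fixedP hx /fixedP hy; apply/fixedP; rewrite exprMn hx hy. Qed.

Lemma fixedX e x i : x \in fixed_field e -> x ^+ i \in fixed_field e.
Proof. by move=> /fixedP hx; apply/fixedP; rewrite exprAC hx. Qed.

Lemma fixedV e x : x \in fixed_field e -> x^-1 \in fixed_field e.
Proof. by move=> /fixedP hx; apply/fixedP; rewrite exprVn hx. Qed.

Lemma fixed0 e : 0 \in fixed_field e.
Proof. by apply/fixedP; rewrite expr0n expn_eq0. Qed.

Lemma fixed1 e : 1 \in fixed_field e.
Proof. by apply/fixedP; rewrite expr1n. Qed.

Lemma fixed_muln e i x : x \in fixed_field e -> x \in fixed_field (e * i).
Proof.
move=> /fixedP hx; apply/fixedP.
by elim: i => [|i IH]; rewrite ?muln0 ?expr1 // mulnS -frobA hx.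
Qed.

Lemma fixed_dvd d e x : (d %| e)%N -> x \in fixed_field d -> x \in fixed_field e.
Proof. by case/dvdnP => i ->; rewrite mulnC; apply: fixed_muln. Qed.

Lemma mem_fixedT x : x \in fixed_field m.
Proof. exact/fixedP/frob_card. Qed.

Lemma fixed_gcdn d e x : (0 < d)%N ->
  x \in fixed_field d -> x \in fixed_field e -> x \in fixed_field (gcdn d e).
Proof.
move=> d_gt0 xd xe; case: (egcdnP e d_gt0) => u v eq_uv _.
apply/fixedP; have /fixedP := fixed_muln u xd.
rewrite mulnC eq_uv -frobA.
by have /fixedP := fixed_muln v xe; rewrite mulnC => ->.
Qed.

(** The polynomial [X^(2^e) - X] divides [X^(2^m) - X], which is the product of all
[X - x]; it is therefore itself such a product, over [2^e] distinct points. *)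
Lemma card_fixed e : (0 < e)%N -> (e %| m)%N -> #|fixed_field e| = (2 ^ e)%N.
Proof.
move=> e_gt0 e_m.
have q_gt1 : (1 < 2 ^ e)%N by rewrite -{1}(expn0 2) ltn_exp2l.
pose p : {poly F} := 'X^(2 ^ e) - 'X.
have szp : size p = (2 ^ e).+1.
  by rewrite size_polyDl size_polyXn // size_polyN size_polyX ltnS.
have p0 : p != 0 by rewrite -size_poly_eq0 szp.
have rootp x : root p x = (x \in fixed_field e).
  by rewrite rootE !hornerE inE subr_eq0.
apply/eqP; rewrite eqn_leq; apply/andP; split.
  rewrite -ltnS -szp cardE; apply: max_poly_roots => //; last exact: enum_uniq.
  by apply/allP => x; rewrite mem_enum rootp.
have : p %| \prod_(x <- index_enum F) ('X - x%:P).
  rewrite -finField_genPoly cardF /p.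
  (* [X^(Q^s) - X] is a [Q]-th power of [X^(Q^(s-1)) - X] plus [X^Q - X]. *)
  case/dvdnP: e_m => s ->; elim: s => [|s IH]; first by rewrite expr1 subrr dvdp0.
  rewrite mulSn.
  have -> : 'X^(2 ^ (e + s * e)) - 'X =
     ('X^(2 ^ (s * e)) - 'X) ^+ (2 ^ e) + ('X^(2 ^ e) - 'X) :> {poly F}.
    have ch2 : 2 \in [pchar {poly F}] by rewrite pchar_poly pchar2F.
    rewrite !(oppr_pchar2 ch2) exprDn_pchar; last first.
      by rewrite (eq_pnat _ (pcharf_eq ch2)) pnatX pnat_id.
    by rewrite -exprM -expnD addnC -addrA (addrA 'X^(2 ^ e)) (addrr_pchar2 ch2) add0r.
  apply: dvdp_add => //; apply: dvdp_trans IH _.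
  by rewrite dvdp_exp // expn_gt0.
move=> /(@dvdp_prod_XsubC _ _ _ id)[mk eqp].
have sz : size (mask mk (index_enum F)) = (2 ^ e)%N.
  by apply: succn_inj; rewrite -szp (eqp_size eqp) size_prod_XsubC.
have uq : uniq (mask mk (index_enum F)) by rewrite mask_uniq ?index_enum_uniq.
rewrite -sz -(card_uniqP uq); apply/subset_leq_card/subsetP => x xm.
by rewrite -rootp (eqp_root eqp) root_prod_XsubC.
Qed.

Lemma traceD x y : ff_trace 2 m (x + y) = ff_trace 2 m x + ff_trace 2 m y :> F.
Proof. by rewrite /ff_trace -big_split; apply: eq_bigr => i _; rewrite frobD. Qed.

Lemma trace_frob1 x : ff_trace 2 m (x ^+ 2) = ff_trace 2 m x :> F.
Proof.
rewrite /ff_trace; have := dim_gt0; have := frob_card x.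
case: m => // k hx _.
rewrite big_ord_recr big_ord_recl /= addrC -exprM -expnS hx expr1; congr (_ + _).
by apply: eq_bigr => i _; rewrite -exprM -expnS.
Qed.

(** The trace is fixed by squaring, hence lies in the prime field. *)
Lemma trace_idem x : (ff_trace 2 m x == 0 :> F) || (ff_trace 2 m x == 1 :> F).
Proof.
have : (ff_trace 2 m x) ^+ 2 = ff_trace 2 m x :> F.
  rewrite -{2}trace_frob1 /ff_trace (frob_sum 1) /=.
  by apply: eq_bigr => i _; rewrite exprAC.
move/eqP; rewrite -subr_eq0 -{2}[ff_trace 2 m x]mulr1 expr2 -mulrBr mulf_eq0.
by rewrite subr_eq0.
Qed.

Lemma trace_signD x y : trace_sign (x + y) = trace_sign x * trace_sign y.
Proof.
rewrite /trace_sign traceD.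
by case/orP: (trace_idem x) => /eqP ->; case/orP: (trace_idem y) => /eqP ->;
   rewrite ?addr0 ?add0r ?addxx ?eqxx ?oner_eq0.
Qed.

Lemma trace_sign0 : trace_sign 0 = 1.
Proof.
rewrite /trace_sign /ff_trace big1 ?eqxx // => i _.
by rewrite expr0n expn_eq0.
Qed.

Lemma trace_sign_frob e x : trace_sign (x ^+ (2 ^ e)) = trace_sign x.
Proof.
elim: e => [|e IH]; first by rewrite expr1.
by rewrite expnSr exprM -IH /trace_sign trace_frob1.
Qed.

Lemma trace_sign_sqr x : trace_sign x ^+ 2 = 1.
Proof. by rewrite /trace_sign; case: ifP. Qed.

Lemma trace_sign_mulxx x : trace_sign x * trace_sign x = 1.
Proof. by rewrite -expr2 trace_sign_sqr. Qed.

(** As a polynomial, the trace has degree [2^(m-1)], too small to vanish on all of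
the [2^m] elements. *)
Lemma trace_sign_neg1 : exists x, trace_sign x = -1.
Proof.
case: (pickP (fun x : F => ff_trace 2 m x != 0)) => [x hx | h].
  by exists x; rewrite /trace_sign (negbTE hx).
pose p : {poly F} := \sum_(i < m) 'X^(2 ^ i).
have szp : size p = (2 ^ m.-1).+1.
  rewrite /p; have := dim_gt0; case: m => // k _.
  rewrite big_ord_recr /= addrC size_polyDl size_polyXn //.
  apply: leq_ltn_trans (size_sum _ _ _) _.
  apply/bigmax_leqP => i _; rewrite size_polyXn.
  by rewrite ltn_exp2l.
have p0 : p != 0 by rewrite -size_poly_eq0 szp.
have allp : all (root p) (enum F).
  apply/allP => x _; rewrite rootE horner_sum; apply/eqP.
  apply: etrans (eqP (negbFE (h x))).
  by rewrite /ff_trace; apply: eq_bigr => i _; rewrite hornerXn.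
have := max_poly_roots p0 allp (enum_uniq F); rewrite -cardE cardF szp ltnS.
by rewrite leq_exp2l // -ltnS prednK ?dim_gt0 // ltnn.
Qed.

(** All conjugates of [x] have the same sign, and there is an odd number of them in
the relative trace. *)
Lemma trace_sign_tower e s x : odd s -> trace_sign (ff_trace (2 ^ e) s x) = trace_sign x.
Proof.
move=> odd_s; rewrite /ff_trace.
rewrite (big_morph trace_sign trace_signD trace_sign0).
rewrite (eq_bigr (fun _ => trace_sign x)) => [|i _]; last first.
  by rewrite -expnM trace_sign_frob.
rewrite prodr_const card_ord -(odd_double_half s) odd_s -muln2 mulnC.
by rewrite exprD exprM trace_sign_sqr expr1n mulr1.
Qed.

Lemma trace_fixed e s x : (e * s)%N = m -> ff_trace (2 ^ e) s x \in fixed_field e.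
Proof.
move=> esm; apply/fixedP; rewrite /ff_trace frob_sum.
have := dim_gt0; have := frob_card x; rewrite -esm.
case: s {esm} => [|k] hx; first by rewrite muln0.
rewrite big_ord_recr big_ord_recl /= addrC -!expnM frobA -mulnSr hx muln0 expr1 => _.
by congr (_ + _); apply: eq_bigr => i _; rewrite -!expnM frobA -mulnSr.
Qed.

(** Non-triviality of the character on a subfield of odd codegree: the relative
trace carries an element of sign -1 down to the subfield. *)
Lemma trace_sign_neg1_fixed e s : (e * s)%N = m -> odd s ->
  exists2 z, z \in fixed_field e & trace_sign z = -1.
Proof.
move=> esm odd_s; have [z hz] := trace_sign_neg1.
by exists (ff_trace (2 ^ e) s z); [apply: trace_fixed | rewrite trace_sign_tower].
Qed.

Lemma sum_fixed_shift e z (f : F -> int) : z \in fixed_field e ->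
  \sum_(x in fixed_field e) f (x + z) = \sum_(x in fixed_field e) f x.
Proof.
move=> ze; rewrite [RHS](reindex_inj (addIr z)); apply: eq_bigl => x.
apply/idP/idP => [xe|]; first exact: fixedD.
by move/fixedD => /(_ _ ze); rewrite -addrA addxx addr0.
Qed.

(** For [w <> 0], translation by an element [z / w] with [psi z = -1] changes the
sign of the sum. *)
Lemma sum_trace_sign_mul e s w : (e * s)%N = m -> odd s -> w \in fixed_field e ->
  \sum_(x in fixed_field e) trace_sign (x * w) =
    if w == 0 then (#|fixed_field e|)%:Z else 0.
Proof.
move=> esm odd_s we; case: eqP => [-> | /eqP w0].
  rewrite (eq_bigr (fun _ => 1)) => [|x _]; last by rewrite mulr0 trace_sign0.
  by rewrite sumr_const natz.
have [z ze hz] := trace_sign_neg1_fixed esm odd_s.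
have zwe : z / w \in fixed_field e by rewrite fixedM ?fixedV.
have := sum_fixed_shift (fun x => trace_sign (x * w)) zwe.
under eq_bigr => x _ do rewrite mulrDl divfK // trace_signD hz mulrN1.
by move/eqP; rewrite sumrN eq_sym -addr_eq0 -mulr2n mulrn_eq0 => /eqP.
Qed.

End BinaryField.

(** * The Jacobi symbol of 2 *)

Lemma jacobi2M v w : odd v -> odd w -> jacobi2 (v * w) = jacobi2 v * jacobi2 w.
Proof.
have odd8 x : odd x -> exists2 i, i \in [:: 1; 3; 5; 7]%N & (x %% 8 = i)%N.
  move=> ox; exists (x %% 8)%N => //; have : odd (x %% 8) by lia.
  have : (x %% 8 < 8)%N by rewrite ltn_mod.
  by move: (x %% 8)%N; do 8! [case=> //].
rewrite /jacobi2 => /odd8[i hi Hv] /odd8[j hj Hw].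
rewrite -modnMml -modnMmr Hv Hw.
move: hi hj; rewrite !inE.
by do 3? [case/orP => [/eqP ->|]]; try move/eqP ->;
   do 3? [case/orP => [/eqP ->|]]; try move/eqP ->.
Qed.

Lemma jacobi2_sqr v : odd v -> jacobi2 v ^+ 2 = 1.
Proof.
move=> ov; rewrite /jacobi2; have : odd (v %% 8) by lia.
have : (v %% 8 < 8)%N by rewrite ltn_mod.
by move: (v %% 8)%N; do 8! [case=> //].
Qed.

(** The second supplement to quadratic reciprocity.  Let [z] be a primitive 8th root
of unity in the algebraic closure of GF(p), and [t = z + z^-1]; then [t^2 = 2], and
[t^p = z^p + z^-p] is [t] or [-t] according to [p] mod 8. *)
Lemma euler_two p : prime p -> odd p -> 2 ^+ p./2 = (jacobi2 p)%:~R :> 'F_p.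
Proof.
move=> p_pr p_odd.
have [K [iota _]] := countable_algebraic_closure 'F_p.
have [z z4] : exists z : K, z ^+ 4 = -1.
  have [z hz] := @solve_monicpoly K 4 (fun i => if i == 0%N then -1 else 0) isT.
  exists z; rewrite hz !big_ord_recl big_ord0 /= expr0.
  by rewrite !mul0r !addr0 mulr1.
have chK : p \in [pchar K] by rewrite (fmorph_pchar iota) pchar_Fp.
have two0 : 2 != 0 :> K.
  rewrite -(dvdn_pcharf chK); apply/negP => /dvdn_leq => /(_ isT).
  by move: p_odd (prime_gt1 p_pr); case: p {p_pr chK iota K z z4} => [|[|[|?]]].
(* Since [z^4 = -1], the inverse of [z] is [- z^3]. *)
pose t := z - z ^+ 3.
have t2 : t ^+ 2 = 2.
  have -> : t ^+ 2 = z ^+ 2 - (z ^+ 4) *+ 2 + z ^+ 4 * z ^+ 2 by rewrite /t; ring.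
  by rewrite z4; ring.
have z8 : z ^+ 8 = 1 by rewrite (exprM z 4 2) z4 sqrrN expr1n.
have tp : t ^+ p = (jacobi2 p)%:~R * t.
  rewrite -(pFrobenius_autE chK) rmorphB rmorphXn /= !pFrobenius_autE.
  rewrite -(expr_mod p z8) /jacobi2 /t.
  have : odd (p %% 8) by lia.
  have : (p %% 8 < 8)%N by rewrite ltn_mod.
  have e5 : z ^+ 5 = - z by rewrite exprS z4 mulrN1.
  have e7 : z ^+ 7 = - z ^+ 3 by rewrite (exprD z 3 4) z4 mulrN1.
  case: (p %% 8)%N => [|[|[|[|[|[|[|[|i]]]]]]]] //= _ _; rewrite ?expr1 ?e5 ?e7.
  - by rewrite mul1r.
  - by rewrite -exprM (exprD z 8 1) z8 mulN1r opprB mul1r.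
  - by rewrite exprNn -signr_odd /= mulN1r; ring.
  - rewrite exprNn -signr_odd /= -exprM (exprD z 8 1) z8 mul1r expr1; ring.
have t0 : t != 0 by apply: contraNneq two0 => t0; rewrite -t2 t0 expr0n.
apply: (fmorph_inj iota); rewrite rmorphXn rmorph_nat rmorph_int.
apply: (mulIf t0); rewrite -tp -t2 -exprM mul2n -exprSr.
by rewrite -[in RHS](odd_double_half p) p_odd.
Qed.

(** * The exponential sum of [x^(2^k+1) + x] *)

Section GoldSum.
Variables (F : finFieldType) (m : nat).
Hypothesis cardF : #|F| = (2 ^ m)%N.
Local Notation psi := (@trace_sign F m).
Local Notation fixed_field := (@fixed_field F).

Lemma frob_mem_fixed e k x :
  (x ^+ (2 ^ k) \in fixed_field e) = (x \in fixed_field e).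
Proof.
apply/idP/idP => [|xe]; last exact: fixedX.
by move/fixedP; rewrite exprAC => /(frob_inj cardF)/fixedP.
Qed.

Lemma sum_fixed_frob e k (f : F -> int) :
  \sum_(x in fixed_field e) f (x ^+ (2 ^ k)) = \sum_(x in fixed_field e) f x.
Proof.
rewrite [RHS](reindex_inj (@frob_inj _ _ cardF k)); apply: eq_bigl => x.
by rewrite frob_mem_fixed.
Qed.

(** On [fixed_field (e * p)] the map [x |-> x^(2^e)] generates a group of order
dividing [p], with fixed points [fixed_field e]; the other orbits have [p]
elements. *)
Lemma card_fixed_invariant e p (P : pred F) : prime p ->
  (forall x, P (x ^+ (2 ^ e)) = P x) ->
  #|[set x in fixed_field (e * p) | P x]| = #|[set x in fixed_field e | P x]| %[mod p].
Proof.
move=> p_pr PE.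
(* Outside the subfield the map is made trivial, so that its [p]-th power is 1. *)
pose f x := if x \in fixed_field (e * p) then x ^+ (2 ^ e) else x.
have f_fix x : (f x \in fixed_field (e * p)) = (x \in fixed_field (e * p)).
  by rewrite /f; case: ifP; rewrite ?frob_mem_fixed.
have f_inj : injective f.
  move=> x y fxy; have := f_fix x; rewrite fxy f_fix => yx.
  by move: fxy; rewrite /f yx; case: ifP => // _ /(frob_inj cardF).
pose s := perm f_inj.
have iter_s i x : x \in fixed_field (e * p) -> (s ^+ i)%g x = x ^+ (2 ^ (e * i)).
  move=> xK; elim: i => [|i IH]; first by rewrite expg0 perm1 muln0 expr1.
  rewrite expgSr permM IH permE /f frob_mem_fixed xK.
  by rewrite frobA mulnSr.
have s_p : (s ^+ p = 1)%g.
  apply/permP => x; rewrite perm1; case: (boolP (x \in fixed_field (e * p))) => xK.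
    by rewrite iter_s //; apply/fixedP.
  by apply: permX_fix; rewrite permE /f (negbTE xK).
have pG : (p.-group <[s]>)%g.
  rewrite /pgroup -orderE; apply: (@pnat_dvd _ p); last exact: pnat_id.
  by rewrite order_dvdn s_p.
set A := [set x in fixed_field (e * p) | P x].
have inA y : (y \in A) = (y \in fixed_field (e * p)) && P y by rewrite !inE.
have actsA : ([acts <[s]>, on A | 'P])%g.
  rewrite cycle_subG; apply/astabsP => x; rewrite /= apermE permE !inA f_fix.
  by rewrite /f; case: ifP; rewrite ?PE.
rewrite (pgroup_fix_mod pG actsA); congr (_ %% _)%N; apply: eq_card => x.
rewrite afix_cycle in_setI inA [RHS]inE.
apply/andP/andP => [[/andP[xK Px] /afix1P] | [xe Px]].
  by rewrite /= apermE permE /f xK => /fixedP.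
have xK := fixed_muln p xe; rewrite xK Px; split => //.
by apply/afix1P; rewrite /= apermE permE /f xK; apply/fixedP.
Qed.

Definition gold_sum (k e : nat) : int :=
  \sum_(x in fixed_field e) psi (x ^+ (2 ^ k + 1) + x).

(** The sum is twice the number of points of sign 1, minus the number of points,
and Frobenius preserves both sets. *)
Lemma gold_sum_modp k e p : prime p ->
  (gold_sum k (e * p))%:~R = (gold_sum k e)%:~R :> 'F_p.
Proof.
move=> p_pr.
have card_sum e' (P : pred F) :
    (#|[set x in fixed_field e' | P x]|)%:Z = \sum_(x in fixed_field e') (P x)%:Z.
  rewrite -natz -sum1_card natr_sum big_mkcond [RHS]big_mkcond /=.
  by apply: eq_bigr => x _; rewrite !inE; case: eqP; case: (P x).
have E e' : gold_sum k e' =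
    (#|[set x in fixed_field e' | psi (x ^+ (2 ^ k + 1) + x) == 1]|)%:Z *+ 2
      - (#|[set x in fixed_field e' | predT x]|)%:Z.
  rewrite !card_sum -sumrMnl -sumrB; apply: eq_bigr => x _.
  by rewrite /trace_sign; case: ifP.
have congr_card (P : pred F) : (forall x, P (x ^+ (2 ^ e)) = P x) ->
    (#|[set x in fixed_field (e * p) | P x]|%:Z)%:~R =
    (#|[set x in fixed_field e | P x]|%:Z)%:~R :> 'F_p.
  move=> PE; rewrite -!pmulrn -(Fp_nat_mod p_pr) (card_fixed_invariant p_pr PE).
  exact: Fp_nat_mod.
rewrite !E !(rmorphB, rmorphMn) /= !congr_card // => x.
by rewrite exprAC -(frobD cardF) (trace_sign_frob cardF).
Qed.

(** Substituting [y + x] for the second variable in the double sum leaves [psi] of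
the quadratic form in [y] times a sum over [x] of [psi] of a linear form, which
vanishes unless [y] is in the radical.  The radical is the field with [2^d]
elements, on which the quadratic form is [y^2 + y], of trace 0. *)
Lemma gold_sum_sqr k d e s : (e * s)%N = m -> odd s -> (0 < d)%N -> (d %| k)%N ->
  gcdn e (2 * k) = d -> gold_sum k e ^+ 2 = 2 ^+ (e + d).
Proof.
move=> esm odd_s d_gt0 d_k gcd_d.
have e_gt0 : (0 < e)%N by move: (dim_gt0 cardF); rewrite -esm; case: (e).
have d_e : (d %| e)%N by rewrite -gcd_d dvdn_gcdl.
have e_m : (e %| m)%N by rewrite -esm dvdn_mulr.
(* The bilinear form is [Tr (x^(2^k) y + x y^(2^k))]; raising the second term to
   the power [2^k] makes [x^(2^k)] a common factor. *)
rewrite expr2 {1}/gold_sum mulr_suml.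
transitivity (\sum_(x in fixed_field e) \sum_(y in fixed_field e)
    psi (y ^+ (2 ^ k + 1) + y) * psi (x ^+ (2 ^ k) * (y + y ^+ (2 ^ (2 * k))))).
  apply: eq_bigr => x xe.
  rewrite /gold_sum -(sum_fixed_shift cardF _ xe) mulr_sumr; apply: eq_bigr => y _.
  set X := x ^+ (2 ^ k); set Y := y ^+ (2 ^ k).
  have -> : y ^+ (2 ^ (2 * k)) = Y ^+ (2 ^ k) by rewrite frobA addnn mul2n.
  rewrite mulrDr -exprMn !(trace_signD cardF) (trace_sign_frob cardF).
  rewrite -!(trace_signD cardF).
  congr psi; rewrite !exprD !expr1 (frobD cardF) -/X -/Y.
  by rewrite -[RHS]addr0 -(addxx cardF (X * x + x)); ring.
rewrite exchange_big /=.
transitivity (\sum_(y in fixed_field e) if y \in fixed_field d then (2 ^ e)%:Z else 0).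
  apply: eq_bigr => y ye; rewrite -mulr_sumr.
  rewrite (sum_fixed_frob e k (fun x => psi (x * _))).
  rewrite (sum_trace_sign_mul cardF esm odd_s) ?(fixedD cardF) ?fixedX //.
  have -> : (y + y ^+ (2 ^ (2 * k)) == 0) = (y \in fixed_field d).
    rewrite addr_eq0 (oppF cardF) eq_sym; apply/eqP/idP => [yk | yd].
      rewrite -gcd_d; apply: fixed_gcdn => //; exact/fixedP.
    by apply/fixedP; apply: fixed_dvd yd; rewrite dvdn_mull.
  case: ifP => yd; last by rewrite mulr0.
  rewrite (card_fixed cardF) //.
  have /fixedP yk := fixed_dvd d_k yd.
  rewrite exprD yk expr1 (trace_signD cardF) -expr2 (trace_sign_frob cardF 1).
  by rewrite trace_sign_mulxx mul1r.
transitivity (\sum_(y in fixed_field d) (2 ^ e)%:Z).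
  rewrite big_mkcond [RHS]big_mkcond; apply: eq_bigr => y _ /=.
  case: (boolP (y \in fixed_field d)) => [yd|_].
    by rewrite (fixed_dvd d_e yd).
  by case: ifP.
rewrite sumr_const (card_fixed cardF) ?(dvdn_trans d_e) //.
by rewrite -natz -mulrnA natz -expnD natrX.
Qed.

(** Here [x^(2^k) = x], so that the summand is [psi (x^2 + x) = 1]. *)
Lemma gold_sum_base k d : (0 < d)%N -> (d %| m)%N -> (d %| k)%N ->
  gold_sum k d = 2 ^+ d.
Proof.
move=> d_gt0 d_m d_k; rewrite /gold_sum (eq_bigr (fun _ => 1)) => [|x xd].
  by rewrite sumr_const (card_fixed cardF) // natrX.
have /fixedP xk := fixed_dvd d_k xd.
rewrite exprD xk expr1 (trace_signD cardF) -expr2 (trace_sign_frob cardF 1).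
by rewrite trace_sign_mulxx.
Qed.

(** Removing a prime factor [p] from [w], the congruence mod [p] decides between the
two square roots of [2^(dw+d)], because [p] is odd.  The codegree [s] absorbs the
removed primes, so that the induction stays inside [F]. *)
Lemma gold_sum_value k d w s : (d * w * s)%N = m -> odd w -> odd s ->
  (0 < d)%N -> (d %| k)%N -> gcdn (d * w) (2 * k) = d ->
  gold_sum k (d * w) = jacobi2 w ^+ d * 2 ^+ (d * w.+1./2).
Proof.
elim/ltn_ind: w s => w IH s dwsm odd_w odd_s d_gt0 d_k gcd_d.
have [w_le1 | w_gt1] := leqP w 1.
  have w1 : w = 1%N by case: w w_le1 odd_w {IH dwsm gcd_d} => [|[|]].
  rewrite w1 !muln1 expr1n mul1r; apply: gold_sum_base => //.
  by rewrite -dwsm -mulnA dvdn_mulr.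
pose p := pdiv w; have p_pr : prime p by exact: pdiv_prime.
have wE : w = (w %/ p * p)%N by rewrite divnK ?pdiv_dvd.
set w' := (w %/ p)%N in wE.
have [odd_w' odd_p] : odd w' /\ odd p by apply/andP; rewrite -oddM -wE.
have w'_lt : (w' < w)%N by rewrite ltn_Pdiv ?prime_gt1 // ltnW.
have IHw' : gold_sum k (d * w') = jacobi2 w' ^+ d * 2 ^+ (d * w'.+1./2).
  apply: (IH w' w'_lt (p * s)%N) => //; first by rewrite -dwsm wE; ring.
    by rewrite oddM odd_p.
  apply/eqP; rewrite eqn_dvd dvdn_gcd dvdn_mulr //= dvdn_mull // andbT.
  rewrite -[X in (_ %| X)%N]gcd_d dvdn_gcd dvdn_gcdr andbT.
  by rewrite (dvdn_trans (dvdn_gcdl _ _)) // wE mulnA dvdn_mulr.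
have := gold_sum_modp k (d * w') p_pr.
rewrite -mulnA -wE IHw' rmorphM !rmorphXn /= => congr_p.
have half_w : (w.+1./2 = w'.+1./2 + w' * p./2)%N.
  have := odd_double_half w'; have := odd_double_half p; rewrite odd_w' odd_p.
  set i := w'./2; set j := p./2 => pE w'E.
  by rewrite wE -pE -w'E -!muln2; lia.
have jacobi2_w : jacobi2 w = jacobi2 w' * jacobi2 p.
  by rewrite -jacobi2M //; congr jacobi2.
have jacobi2_sqrF v : odd v -> (jacobi2 v)%:~R ^+ 2 = 1 :> 'F_p.
  by move=> odd_v; rewrite -rmorphXn /= jacobi2_sqr.
have target_p : (jacobi2 w ^+ d * 2 ^+ (d * w.+1./2))%:~R =
    (gold_sum k (d * w))%:~R :> 'F_p.
  have cancel_p : (jacobi2 p)%:~R ^+ d * 2 ^+ (d * (w' * p./2)) = 1 :> 'F_p.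
    rewrite mulnA mulnC exprM euler_two // -exprD -mulnS.
    have -> : (d * w'.+1 = 2 * (d * w'.+1./2))%N.
      by rewrite mulnCA mul2n even_halfK //= odd_w'.
    by rewrite exprM jacobi2_sqrF // expr1n.
  rewrite congr_p half_w rmorphM !rmorphXn /= jacobi2_w mulnDr exprD.
  by rewrite rmorphM exprMn mulrACA cancel_p mulr1.
have : gold_sum k (d * w) ^+ 2 == (jacobi2 w ^+ d * 2 ^+ (d * w.+1./2)) ^+ 2.
  rewrite (@gold_sum_sqr k d (d * w) s) // exprMn (exprAC (jacobi2 w)) jacobi2_sqr //.
  rewrite expr1n mul1r -exprM; apply/eqP; congr (_ ^+ _).
  by rewrite -mulnA muln2 even_halfK /= ?odd_w // mulnS addnC.
rewrite eqf_sqr => /orP[/eqP -> // | /eqP gold_neg].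
exfalso.
have two0 : 2 != 0 :> 'F_p.
  rewrite -(dvdn_pcharf (pchar_Fp p_pr)); apply/negP => /dvdn_leq => /(_ isT).
  by move: odd_p (prime_gt1 p_pr); case: (p) => [|[|[|?]]].
have jw0 : (jacobi2 w)%:~R != 0 :> 'F_p.
  have := jacobi2_sqrF w odd_w; apply: contra_eq_neq => ->.
  by rewrite expr0n eq_sym oner_eq0.
move: target_p; rewrite gold_neg rmorphN /= => /eqP; rewrite -addr_eq0 -mulr2n.
rewrite -(mulr_natl (_%:~R)) rmorphM !rmorphXn /= !mulf_eq0 !expf_eq0.
by rewrite (negbTE two0) (negbTE jw0) !andbF.
Qed.

End GoldSum.

(** * Counting points by characters *)

Section Counting.
Variables (F : finFieldType) (m : nat).
Hypothesis cardF : #|F| = (2 ^ m)%N.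
Local Notation psi := (@trace_sign F m).
Local Notation fixed_field := (@fixed_field F).

Lemma sum_trace_sign_mulT w : \sum_x psi (x * w) = if w == 0 then 2 ^+ m else 0.
Proof.
have m_gt0 := dim_gt0 cardF.
have := sum_trace_sign_mul cardF (muln1 m) isT (mem_fixedT cardF w).
rewrite (card_fixed cardF) // -natz natrX => <-.
by apply: eq_bigl => x; rewrite (mem_fixedT cardF).
Qed.

(** The indicator of [y^q - y = z] is [2^-m] times the sum over all [t] of
[psi (t (y^q - y - z))]; summing over [y] first keeps the [t] with [t^q = t], as
[psi (t y) = psi (t^q y^q)]. *)
Lemma card_artin_schreier n z :
  (#|[set y : F | y ^+ (2 ^ n) - y == z]|)%:Z = \sum_(t in fixed_field n) psi (t * z).
Proof.
have two_m : 2 ^+ m != 0 :> int by rewrite expf_neq0.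
apply: (mulIf two_m); rewrite -sum1_card -natz natr_sum !mulr_suml.
transitivity (\sum_y \sum_t psi (t * (y ^+ (2 ^ n) - y - z))).
  rewrite big_mkcond; apply: eq_bigr => y _; rewrite sum_trace_sign_mulT inE subr_eq0.
  by case: ifP => _; rewrite ?mul1r.
rewrite exchange_big [RHS]big_mkcond; apply: eq_bigr => t _ /=.
transitivity (psi (t * z) * \sum_y psi (y * (t + t ^+ (2 ^ n)))).
  rewrite [in RHS](reindex_inj (@frob_inj _ _ cardF n)) mulr_sumr; apply: eq_bigr => y _.
  rewrite !(oppF cardF) mulrDr (trace_signD cardF) mulrC; congr (_ * _).
  by rewrite !mulrDr -exprMn !(trace_signD cardF) (trace_sign_frob cardF) !(mulrC t).
rewrite sum_trace_sign_mulT addr_eq0 (oppF cardF) eq_sym inE.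
by case: ifP; rewrite ?mulr0.
Qed.

Definition twisted_sum (k : nat) (beta : F) : int :=
  \sum_x psi (x ^+ (2 ^ k + 1) + beta * x).

(** Every [t] in GF(q) is a square [mu^2], and replacing [x] by [mu x] multiplies
[x^(q^r+1)] by [mu^2]. *)
Lemma npoints_twisted n r b c :
  (npoints (2 ^ n) r 1 b c)%:Z =
  2 ^+ m + \sum_(mu in fixed_field n | mu != 0)
             psi (mu ^+ 2 * c) * twisted_sum (n * r) (mu * b).
Proof.
have -> : (npoints (2 ^ n) r 1 b c)%:Z =
    \sum_x \sum_(t in fixed_field n) psi (t * (x ^+ (2 ^ (n * r) + 1) + b * x + c)).
  rewrite /npoints -sum1_card -natz natr_sum.
  rewrite (eq_bigl (fun P : F * F => true &&
      (P.2 ^+ (2 ^ n) - P.2 == P.1 ^+ (2 ^ (n * r) + 1) + b * P.1 + c))); last first.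
    by move=> P; rewrite inE mul1r -expnM.
  rewrite -(pair_big_dep xpredT
    (fun x y => y ^+ (2 ^ n) - y == x ^+ (2 ^ (n * r) + 1) + b * x + c)
    (fun _ _ => 1)) /=.
  apply: eq_bigr => x _; rewrite -card_artin_schreier -natz -sum1_card natr_sum.
  by apply: eq_bigl => y; rewrite inE.
rewrite exchange_big /= -(sum_fixed_frob cardF n 1) /=.
rewrite (bigD1 0) ?fixed0 //=; congr (_ + _).
  rewrite (eq_bigr (fun _ => 1)) => [|x _]; last by rewrite expr0n mul0r trace_sign0.
  by rewrite sumr_const cardF natrX.
apply: eq_bigr => mu /andP[mu_n mu0].
rewrite /twisted_sum [in RHS](reindex_inj (mulfI mu0)) mulr_sumr; apply: eq_bigr => x _.
rewrite -(trace_signD cardF); congr psi.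
have /fixedP mu_k := fixed_muln r mu_n.
rewrite exprMn (exprD mu) mu_k expr1 expn1; ring.
Qed.

Section Tower.
Variables (k d v : nat).
Hypotheses (dvm : (d * v)%N = m) (odd_v : odd v) (d_k : (d %| k)%N).

Local Notation T := (@ff_trace F (2 ^ d) v).

Lemma rel_traceZ z x : z \in fixed_field d -> T (z * x) = z * T x.
Proof.
move=> zd; rewrite /ff_trace mulr_sumr; apply: eq_bigr => i _.
by rewrite exprMn -expnM; have /fixedP -> := fixed_muln i zd.
Qed.

Lemma rel_trace1D x : T (1 + x) = 1 + T x.
Proof.
rewrite /ff_trace; under eq_bigr => i _ do rewrite -expnM (frobD cardF) expr1n.
rewrite big_split /= sumr_const card_ord; congr (_ + _).
  rewrite -(odd_double_half v) odd_v -addnn natrD natrD (addxx cardF) addr0 //.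
by apply: eq_bigr => i _; rewrite expnM.
Qed.

(** Translating [x] by [z] in the radical multiplies the sum by
[psi (z^2 + beta z) = psi (z (1 + T beta))]; if [1 + T beta] is nonzero, some [z]
makes this factor equal to -1. *)
Lemma twisted_sum_eq0 beta : T beta != 1 -> twisted_sum k beta = 0.
Proof.
move=> T1.
have w0 : 1 + T beta != 0 by rewrite addr_eq0 (oppF cardF) eq_sym.
have [z0 z0d psi_z0] := trace_sign_neg1_fixed cardF dvm odd_v.
have wd : 1 + T beta \in fixed_field d.
  by rewrite (fixedD cardF) ?fixed1 ?(trace_fixed cardF).
pose z := z0 / (1 + T beta).
have zd : z \in fixed_field d by rewrite fixedM ?fixedV.
have psi_z : psi (z * (1 + beta)) = -1.
  rewrite -(trace_sign_tower cardF d _ odd_v) rel_traceZ // rel_trace1D.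
  by rewrite /z divfK.
have zk : z ^+ (2 ^ k) = z by apply/fixedP; apply: fixed_dvd zd.
have : twisted_sum k beta = psi (z * (1 + beta)) * twisted_sum k beta.
  rewrite {1}/twisted_sum (reindex_inj (addIr z)) mulr_sumr; apply: eq_bigr => x _.
  rewrite !exprD !expr1 (frobD cardF) zk.
  have -> : (x ^+ (2 ^ k) + z) * (x + z) + beta * (x + z) =
    (x ^+ (2 ^ k) * x + beta * x) + (z * x ^+ (2 ^ k) + z * x + z ^+ 2 + z * beta).
    by ring.
  have zx : psi (z * x ^+ (2 ^ k)) = psi (z * x).
    by rewrite -{1}zk -exprMn (trace_sign_frob cardF).
  rewrite !(trace_signD cardF) zx trace_sign_mulxx mul1r.
  by rewrite (trace_sign_frob cardF 1) mulrDr mulr1 (trace_signD cardF) mulrC.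
rewrite psi_z mulN1r => /eqP.
by rewrite -addr_eq0 -mulr2n mulrn_eq0 => /eqP.
Qed.

End Tower.

(** Completing the square: for [W = w^(2^k)], the cross terms of [(x + W)^(2^k+1)]
have the trace of [(w^(2^(2k)) + w) x]. *)
Lemma twisted_sum_shift k w :
  twisted_sum k (w ^+ (2 ^ (2 * k)) + w + 1) =
  psi (w ^+ (2 ^ k + 1) + w) * gold_sum F m k m.
Proof.
set W := w ^+ (2 ^ k).
have WE : w ^+ (2 ^ (2 * k)) = W ^+ (2 ^ k) by rewrite frobA addnn mul2n.
have -> : gold_sum F m k m = \sum_x psi ((x + W) ^+ (2 ^ k + 1) + (x + W)).
  rewrite -(reindex_inj (addIr W) (P := xpredT)
    (F := fun x => psi (x ^+ (2 ^ k + 1) + x))).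
  by apply: eq_bigl => x; rewrite (mem_fixedT cardF).
rewrite mulr_sumr; apply: eq_bigr => x _.
have -> : psi (w ^+ (2 ^ k + 1) + w) = psi (W ^+ (2 ^ k + 1) + W).
  by rewrite -(trace_sign_frob cardF k) (frobD cardF) exprAC.
rewrite -(trace_signD cardF) WE !exprD !expr1 (frobD cardF).
set X := x ^+ (2 ^ k); set V := W ^+ (2 ^ k).
have -> : V * W + W + ((X + V) * (x + W) + (x + W)) =
  X * x + V * x + x + X * W + (V * W + V * W) + (W + W) by ring.
rewrite !(addxx cardF) !addr0 (trace_signD cardF _ (X * W)) -exprMn.
by rewrite (trace_sign_frob cardF) -(trace_signD cardF); congr psi; ring.
Qed.

End Counting.

(** * The number of points of the curve *)

Lemma chi1_trace_sign (R : realType) (F : finFieldType) m (x : F) : #|F| = (2 ^ m)%N ->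
  chi1 R 2 x = (trace_sign m x)%:~R.
Proof.
move=> cardF.
have cexp0 : cexp (0 : R[i]) = 1 by rewrite /cexp /= expR0 cos0 sin0 mulr1 mulr0.
have cexp_pi : cexp (2 * Complex pi 0 * Complex 0 1 * 1 / 2 : R[i]) = -1.
  have -> : 2 * Complex pi 0 * Complex 0 1 * 1 / 2 = Complex 0 pi :> R[i].
    rewrite mulr1 mulrC !mulrA mulVf ?pnatr_eq0 // mul1r.
    by apply/eqP; rewrite eq_complex /= !mul0r !mulr0 !mulr1 subr0 addr0 !eqxx.
  rewrite /cexp /= expR0 cospi sinpi !mul1r.
  by apply/eqP; rewrite eq_complex /= oppr0 !eqxx.
rewrite /chi1 /abs_trace cardF pfactorK // /trace_sign.
case: pickP => [[[|[|i]] // ilt] /= | none].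
- by move=> /eqP <-; rewrite eqxx mulr0 mul0r cexp0.
- by move=> /eqP <-; rewrite oner_eq0 cexp_pi.
case/orP: (trace_idem cardF x) => /eqP tr.
  by have := none 0; rewrite tr eqxx.
by have := none 1; rewrite tr eqxx.
Qed.

Lemma npoints_scale (F : finFieldType) (q r : nat) (a1 b c : F) : a1 != 0 ->
  npoints q r (a1 ^+ (q ^ r + 1)) b c = npoints q r 1 (b * a1^-1) c.
Proof.
move=> a1_neq0; rewrite /npoints.
have f_inj : injective (fun P : F * F => (a1 * P.1, P.2)).
  by move=> [x y] [x' y'] /= [/(mulfI a1_neq0) -> ->].
rewrite -!sum1_card [RHS](reindex_inj f_inj); apply: eq_bigl => P.
by rewrite !inE /= mul1r exprMn -mulrA mulKf.
Qed.

Theorem theorem3p3 (R : realType) (n q l r u : nat)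
    (hn : (1 <= n)%N) (hq : q = (2 ^ n)%N)
    (hl : (2 <= l)%N) (hu : u = gcdn l r) (hodd : odd (l %/ u))
    (F : finFieldType) (hF : #|F| = (q ^ l)%N)
    (a b c : F) (ha : a != 0)
    (a1 : F) (ha1_neq0 : a1 != 0) (ha1 : a1 ^+ (q ^ r + 1) = a) :
  let T := @ff_trace F (q ^ u) (l %/ u) in
  npoints q r a b c = npoints q r 1 (b * a1^-1) c /\
  (T b \notin subfield_star F q -> npoints q r 1 b c = (q ^ l)%N) /\
  (T b \in subfield_star F q ->
   forall omega : F,
   b * (T b)^-1 = omega ^+ (q ^ (2 * r)) + omega + 1 ->
   (npoints q r 1 b c)%:R =
     (q ^ l)%:R
     + chi1 R 2 (omega ^+ (q ^ r + 1) + omega)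
       * (jacobi2 (l %/ u))%:~R ^+ (n * u)
       * (q ^ ((l + u) %/ 2))%:R
       * chi1 R 2 ((T b) ^- 2 * c)).
Proof.
move=> T; split; first by rewrite -ha1 npoints_scale.
pose m := (n * l)%N; pose k := (n * r)%N; pose d := (n * u)%N; pose v := (l %/ u)%N.
have cardF : #|F| = (2 ^ m)%N by rewrite hF hq -expnM.
have u_gt0 : (0 < u)%N by rewrite hu gcdn_gt0 (ltn_trans _ hl).
have lE : l = (u * v)%N by rewrite mulnC divnK // hu dvdn_gcdl.
have dvm : (d * v)%N = m by rewrite /m lE mulnA.
have d_gt0 : (0 < d)%N by rewrite muln_gt0 hn.
have d_k : (d %| k)%N by rewrite dvdn_pmul2l // hu dvdn_gcdr.
have gcd_d : gcdn (d * v) (2 * k) = d.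
  rewrite dvm mulnCA -muln_gcdr; congr (_ * _)%N.
  have rE : r = (u * (r %/ u))%N by rewrite mulnC divnK // hu dvdn_gcdr.
  rewrite lE rE mulnCA -muln_gcdr; move: hu; rewrite {1}lE {1}rE -muln_gcdr => huv.
  have {}huv : gcdn v (r %/ u) = 1%N.
    by apply/eqP; rewrite -(eqn_pmul2l u_gt0) muln1 -huv.
  by rewrite Gauss_gcdr ?huv ?muln1 // coprimen2.
have TE : T = @ff_trace F (2 ^ d) v by rewrite /T hq -expnM.
have starE x : (x \in subfield_star F q) = (x \in fixed_field F n) && (x != 0).
  by rewrite !inE hq.
have TM mu : mu \in fixed_field F n -> T (mu * b) = mu * T b.
  by move=> mu_n; rewrite TE rel_traceZ // fixed_muln.
have sum_eq0 mu : mu \in fixed_field F n -> mu * T b != 1 ->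
    trace_sign m (mu ^+ 2 * c) * twisted_sum m k (mu * b) = 0.
  move=> mu_n muT; rewrite (twisted_sum_eq0 cardF dvm hodd d_k) ?mulr0 //.
  by rewrite -TE TM.
have := npoints_twisted cardF n r b c; rewrite -hq -/k => npE.
split=> [Tb | Tb omega bE].
  apply/eqP; rewrite -eqz_nat npE big1 ?addr0 => [|mu /andP[mu_n mu0]].
    by rewrite -hF cardF -natz natrX.
  apply: sum_eq0 => //; apply: contraNneq Tb => muT; rewrite starE.
  have <- : mu^-1 = T b by apply: (mulfI mu0); rewrite muT mulfV.
  by rewrite fixedV // invr_eq0.
have /andP[Tb_n Tb0] : (T b \in fixed_field F n) && (T b != 0) by rewrite -starE.
have gold : gold_sum F m k m = jacobi2 v ^+ d * 2 ^+ (d * v.+1./2).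
  rewrite -{2}dvm; apply: (@gold_sum_value _ _ cardF k d v 1) => //.
  by rewrite muln1.
have npE2 : (npoints q r 1 b c)%:Z = 2 ^+ m + trace_sign m (omega ^+ (q ^ r + 1) + omega)
    * jacobi2 v ^+ d * 2 ^+ (d * v.+1./2) * trace_sign m ((T b) ^- 2 * c).
  rewrite npE (bigD1 (T b)^-1) ?fixedV ?invr_eq0 //= big1 => [|mu].
    rewrite addr0 (mulrC _ b) bE hq -!expnM mulnCA twisted_sum_shift // gold -/k.
    by rewrite (exprVn (T b)); ring.
  case/andP=> /andP[mu_n mu0] mu_T; apply: sum_eq0 => //.
  by apply: contraNneq mu_T => muT; apply/eqP/(mulIf Tb0); rewrite muT mulVf.
have -> : (q ^ ((l + u) %/ 2) = 2 ^ (d * v.+1./2))%N.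
  have vE : (v.+1 = v.+1./2.*2)%N by rewrite even_halfK //= hodd.
  rewrite hq -expnM {1}lE addnC -mulnS divn2 /d -mulnA; congr (2 ^ (n * _))%N.
  by rewrite {1}vE -muln2 mulnA muln2 doubleK.
have -> : (q ^ l = 2 ^ m)%N by rewrite hq -expnM.
rewrite [LHS]pmulrn npE2 !(chi1_trace_sign R _ cardF) !natrX.
rewrite rmorphD !rmorphM !rmorphXn /=.
by congr (_ + _); ring.
Qed.
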